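(* Let $d\ge 1$ and $M>1$. Consider the online hitting set problem in which the point set is $\mathbb{Z}^d$ and the objects are axis-aligned hypercubes in $\mathbb{R}^d$ (all homothetic copies of one another) whose widths lie in the range $[1,M]$. Then the competitive ratio of every online algorithm for this problem, whether deterministic or randomized, is $\Omega(d\log M)$.
   Context: Online hitting set problem: a set $\mathcal{P}$ of points is known in advance; objects (here closed axis-aligned hypercubes) arrive one at a time and the sequence of objects is not known in advance. Upon the arrival of each object, the algorithm must ensure that its current solution set $\mathcal{A}\subseteq\mathcal{P}$ contains a point lying in every object presented so far; points can only be added to $\mathcal{A}$, never removed (irrevocable decisions). The competitive ratio of an (possibly randomized) online algorithm is the supremum over all input sequences of the ratio of the (expected) size of its final solution to the minimum size of a subset of $\mathcal{P}$ hitting all objects of the sequence (the offline optimum). The width of an axis-aligned hypercube is half of its side length. *)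

(* Defs.v *)
From HB Require Import structures.
From mathcomp Require Import all_boot all_order all_algebra.
From mathcomp Require Import finmap.
From mathcomp Require Import all_classical all_reals all_analysis.
Set Implicit Arguments. Unset Strict Implicit. Unset Printing Implicit Defensive.
Import Order.TTheory GRing.Theory Num.Theory.
Local Open Scope ring_scope.
Local Open Scope fset_scope.

Definition zpoint (d : nat) := 'rV[int]_d.

(* A closed axis-aligned hypercube in R^d given by (center, width),
   where the width is half the side length:
   cube (c, w) = { x | forall i, |x_i - c_i| <= w }. *)
Definition cube (R : realType) (d : nat) := ('rV[R]_d * R)%type.

Definition hits (R : realType) (d : nat) (p : zpoint d) (Q : cube R d) : bool :=
  [forall i : 'I_d, `|(p ord0 i)%:~R - Q.1 ord0 i| <= Q.2].

Definition allowed (R : realType) (d : nat) (M : R) (Q : cube R d) : bool :=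
  (1 <= Q.2) && (Q.2 <= M).

Definition hitting_set (R : realType) (d : nat) (H : {fset zpoint d})
    (s : seq (cube R d)) : Prop :=
  forall Q, Q \in s -> exists2 p, p \in H & hits p Q.

Definition is_opt (R : realType) (d : nat) (s : seq (cube R d)) (k : nat) : Prop :=
  (exists H : {fset zpoint d}, hitting_set H s /\ #|` H| = k) /\
  (forall H : {fset zpoint d}, hitting_set H s -> (k <= #|` H|)%N).

(* A deterministic online algorithm: A s is its solution after the
   (admissible) prefix s has been presented.  Being a function of the
   prefix only, it cannot see the future; solutions only grow (irrevocable
   decisions); after each arrival the solution hits all objects so far. *)
Definition online_alg (R : realType) (d : nat) (M : R)
    (A : seq (cube R d) -> {fset zpoint d}) : Prop :=
  (forall s, all (allowed M) s -> hitting_set (A s) s) /\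
  (forall s Q, all (allowed M) (rcons s Q) -> A s `<=` A (rcons s Q)).

(* Competitive ratio of a randomized algorithm, given as a probability
   space (Omega, P) and a family of deterministic online algorithms A w
   (w : Omega is the random seed), against an oblivious adversary:
   sup over nonempty admissible sequences s of E[|A(s)|] / OPT(s). *)
Definition comp_ratio (R : realType) (d : nat) (M : R)
    (d0 : measure_display) (Omega : measurableType d0)
    (P : probability Omega R) (A : Omega -> seq (cube R d) -> {fset zpoint d})
    : \bar R :=
  ereal_sup [set r : \bar R | exists (s : seq (cube R d)) (k : nat),
    [/\ s <> [::], all (allowed M) s, is_opt s k &
        r = ((\int[P]_w ((#|` A w s|)%:R)%:E) * ((k%:R)^-1)%:E)%E]].

(* Main.v *)
(* The adversary plays random requests all of which contain a common
   integer point, so that the offline optimum is 1.  It works in phases, one per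
   scale [q = 4^(K-m-1)], with cubes of width [2q - 1]; each phase consists of
   [d] steps.  Step [i] of a phase shifts the [i]-th coordinate of the current
   cube by [2q] up or down, according to a fair coin.  The two outcomes force the
   [i]-th coordinate of the common point to be strictly above, resp. strictly
   below, the unshifted center, so every point of the algorithm's solution is
   ruled out for all later requests with probability at least 1/2.  Since at
   least one point stays relevant after each request, the expected solution grows
   by at least 1/2 per step, which gives [d * K / 2] with [K = log_4 M].  Only the
   cardinalities of the solutions are assumed measurable, so this is averaged over
   the coins for each fixed seed first and integrated over the seeds afterwards. *)
Require Import Defs.
From HB Require Import structures.
From mathcomp Require Import all_boot all_order all_algebra.
From mathcomp Require Import finmap.
From mathcomp Require Import all_classical all_reals all_analysis.
From mathcomp Require Import measurable_realfun zify ring lra.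
Set Implicit Arguments. Unset Strict Implicit. Unset Printing Implicit Defensive.
Import Order.TTheory GRing.Theory Num.Theory.
Local Open Scope fset_scope.
Local Open Scope ring_scope.

(** * Averaging over the tree of coin outcomes *)

(** The expectation of [f] after [k] further fair coins, scaled by [2 ^ k] to remain in [nat]. *)
Fixpoint leaf_sum (f : seq bool -> nat) (k : nat) (b : seq bool) : nat :=
  if k is k'.+1 then
    (leaf_sum f k' (rcons b false) + leaf_sum f k' (rcons b true))%N
  else f b.

(** The adversary without geometry: [U b] holds the points not ruled out by the coins [b]. Divided
    by [2 ^ T], the bound reads: expected size at least [T / 2]. *)
Lemma leaf_sum_card_ge (X : choiceType) (T : nat) (A : seq bool -> {fset X})
    (U : seq bool -> pred X) :
  (forall b e, (size b < T)%N -> A b `<=` A (rcons b e)) ->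
  (forall b e p, U (rcons b e) p -> U b p) ->
  (forall b p, U (rcons b false) p -> ~~ U (rcons b true) p) ->
  (forall b e, (size b < T)%N ->
     exists2 p, p \in A (rcons b e) & U (rcons b e) p) ->
  (2 ^ T * T <= 2 * leaf_sum (fun b => #|` A b|) T [::])%N.
Proof.
move=> Amono Usub Udisj Ahit.
pose alive b := #|` [fset p in A b | U b p]|.
have alive_gt0 b e : (size b < T)%N -> (0 < alive (rcons b e))%N.
  move=> /(Ahit b e)[p pA pU]; rewrite /alive cardfs_gt0.
  by apply/fset0Pn; exists p; rewrite !inE /= pA.
pose surv b e := #|` [fset p in A b | U (rcons b e) p]|.
(* Inclusion-exclusion: the alive points and [A b] both lie in [A (rcons b e)] and meet only in
   survivors. *)
have new b e : (size b < T)%N ->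
    (alive (rcons b e) + #|` A b| <= #|` A (rcons b e)| + surv b e)%N.
  move=> /(Amono b e) AS; rewrite /alive /surv -cardfsUI.
  apply: leq_add; apply: fsubset_leq_card; apply/fsubsetP => p; rewrite !inE /=.
    by case/orP=> [/andP[]//|]; exact: (fsubsetP AS).
  by case/andP=> /andP[_ ->] ->.
have halve b : (surv b false + surv b true <= alive b)%N.
  rewrite /surv -cardfsUI.
  have -> : [fset p in A b | U (rcons b false) p] `&`
            [fset p in A b | U (rcons b true) p] = fset0.
    apply/fsetP => p; rewrite !inE /=; apply/negP.
    by case/andP=> /andP[_ /Udisj/negPf->]; rewrite andbF.
  rewrite cardfs0 addn0; apply: fsubset_leq_card; apply/fsubsetP => p.
  by rewrite !inE /= => /orP[]/andP[-> /Usub].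
(* On average over the two children of b, [2 * #|` A b| - alive b] grows by
   at least one: the expected number of survivors is at most [alive b / 2]. *)
have main k b : (size b + k = T)%N ->
    (2 ^ k * (2 * #|` A b| + k) <=
     2 * leaf_sum (fun b => #|` A b|) k b + 2 ^ k * alive b)%N.
  elim: k b => [|k IHk] b sb /=; first by rewrite expn0; lia.
  have bT : (size b < T)%N by lia.
  have sizeS e : (size (rcons b e) + k = T)%N by rewrite size_rcons; lia.
  have := IHk _ (sizeS false); have := IHk _ (sizeS true).
  have := new b false bT; have := new b true bT; have := halve b.
  have := alive_gt0 b false bT; have := alive_gt0 b true bT.
  rewrite expnS.
  move: (alive _) (alive _) (alive _) (surv _ _) (surv _ _) => a1 a0 a s0 s1.
  by move: (2 ^ k)%N => q; nia.
have := main T [::] erefl.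
have : (alive [::] <= #|` A [::]|)%N.
  by apply: fsubset_leq_card; apply/fsubsetP => p; rewrite !inE => /andP[].
by move: (2 ^ T)%N => q; nia.
Qed.

Lemma measurable_leaf_sum (R : realType) (d0 : measure_display)
    (Omega : measurableType d0) (f : Omega -> seq bool -> nat) (k : nat)
    (b : seq bool) :
  (forall b, measurable_fun setT (fun w => (f w b)%:R : R)) ->
  measurable_fun setT (fun w => (leaf_sum (f w) k b)%:R : R).
Proof.
move=> mf; elim: k b => //= k IHk b.
under eq_fun do rewrite natrD.
exact: measurable_funD.
Qed.

(** Derandomization: at each node some child is at least the average, and following it yields one
    coin sequence, the same for all seeds. *)
Lemma exists_leaf_integral_ge (R : realType) (d0 : measure_display)
    (Omega : measurableType d0) (P : probability Omega R)
    (f : Omega -> seq bool -> nat) (x : R) (k : nat) (b : seq bool) :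
  (forall b, measurable_fun setT (fun w => (f w b)%:R : R)) ->
  ((2 ^+ k * x)%:E <= \int[P]_w ((leaf_sum (f w) k b)%:R)%:E)%E ->
  exists2 t, size t = k & (x%:E <= \int[P]_w ((f w (b ++ t))%:R)%:E)%E.
Proof.
move=> mf; elim: k b => [|k IHk] b /=.
  by rewrite expr0 mul1r => ?; exists [::]; rewrite ?cats0.
under eq_integral do rewrite natrD EFinD.
rewrite ge0_integralD //=.
- move=> ge; pose I e := (\int[P]_w ((leaf_sum (f w) k (rcons b e))%:R)%:E)%E.
  have [e Ie] : exists e, ((2 ^+ k * x)%:E <= I e)%E.
    have [?|lt0] := leP (2 ^+ k * x)%:E (I false); first by exists false.
    have [?|lt1] := leP (2 ^+ k * x)%:E (I true); first by exists true.
    have := lteD lt0 lt1; rewrite -EFinD => /(le_lt_trans ge).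
    by rewrite lte_fin exprS -mulrA mulr_natl mulr2n ltxx.
  have [t <- ft] := IHk _ Ie.
  by exists (e :: t); rewrite // -cat_rcons.
- by apply/measurable_EFinP; exact: measurable_leaf_sum.
- by apply/measurable_EFinP; exact: measurable_leaf_sum.
Qed.

(** * One coordinate: expansions in powers of 4 with digits 1 and -1 *)

Definition sgb (e : bool) : int := if e then 1 else -1.

Definition scale (K m : nat) : int := (4 ^ (K - m))%N%:Z.

Lemma scaleS K m : (m < K)%N -> scale K m = 4 * scale K m.+1.
Proof. by move=> mK; rewrite /scale -PoszM -expnS subnSK. Qed.

Lemma scale_gt0 K m : 0 < scale K m.
Proof. by rewrite /scale ltz_nat expn_gt0. Qed.

Lemma scale_anti K m n : (m <= n)%N -> scale K n <= scale K m.
Proof. by move=> mn; rewrite /scale lez_nat leq_exp2l // leq_sub2l. Qed.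

Definition node (K : nat) (s : nat -> bool) (m : nat) : int :=
  \sum_(l < m) sgb (s l) * scale K l.+1.

Lemma nodeS K s m : node K s m.+1 = node K s m + sgb (s m) * scale K m.+1.
Proof. exact: big_ord_recr. Qed.

Lemma eq_node K s s' m : (forall l, (l < m)%N -> s l = s' l) ->
  node K s m = node K s' m.
Proof. by move=> ss'; apply: eq_bigr => l _; rewrite ss'. Qed.

(** Geometric series of ratio 4: the steps from [m] to [n] add up to at most a third of
    [scale K m - scale K n]. *)
Lemma node_dist K s m n : (m <= n <= K)%N ->
  3 * `|node K s n - node K s m| <= scale K m - scale K n.
Proof.
case/andP; elim: n => [|n IHn]; first by case: m => // _ _; rewrite !subrr.
rewrite leq_eqVlt => /predU1P[-> _|]; first by rewrite !subrr normr0 mulr0.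
rewrite ltnS => mn nK; have := IHn mn (ltnW nK).
rewrite nodeS (scaleS nK); have := scale_gt0 K n.+1.
by case: (s n); rewrite /sgb; lia.
Qed.

(* The difference [node K s K - icenter K s m started] is, up to the tail of
   the expansion, [+- scale K m.+1]: the target lies halfway between the unshifted
   and the shifted centers, within distance [2 * scale K m.+1 - 1] of both. *)
Definition icenter (K : nat) (s : nat -> bool) (m : nat) (started : bool) : int :=
  node K s m + (if started then sgb (s m) * (2 * scale K m.+1) else 0).

Lemma node_near_icenter K s m started : (m < K)%N ->
  `|node K s K - icenter K s m started| <= 2 * scale K m.+1 - 1.
Proof.
move=> mK; have := @node_dist K s m.+1 K; rewrite mK leqnn => /(_ isT).
rewrite /icenter nodeS; have := scale_gt0 K m.+1.
have -> : scale K K = 1 by rewrite /scale subnn.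
by case: (s m); case: started; rewrite /sgb; lia.
Qed.

(** The step away from [node K s l] outweighs all later drift, the shift and the width. For [l = m]
    and, in the worst case, for [l < m], the margin left is exactly the 1 subtracted in the
    width. *)
Lemma icenter_side K s m l (started : bool) (z : int) : (m < K)%N ->
  (l < m + started)%N -> `|z - icenter K s m started| <= 2 * scale K m.+1 - 1 ->
  0 < sgb (s l) * (z - node K s l).
Proof.
move=> mK; case: (ltnP l m) => [lm _|ml lm'].
  have := @node_dist K s l.+1 m; rewrite lm (ltnW mK) => /(_ isT).
  have := scale_anti K lm; rewrite /icenter nodeS (scaleS mK).
  have := scale_gt0 K m.+1.
  by case: (s m); case: (s l); case: started; rewrite /sgb; lia.
have [-> ->] : l = m /\ started = true by case: started lm'; lia.
rewrite /icenter; have := scale_gt0 K m.+1.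
by case: (s m); rewrite /sgb; lia.
Qed.

(** * The requests in dimension [d] *)

(* The coin of step [m * d + j] moves coordinate [j] in phase [m]. *)
Definition digit (d : nat) (b : seq bool) (j m : nat) : bool :=
  nth false b (m * d + j).

Lemma digit_cat d b b' j m : (m * d + j < size b)%N ->
  digit d (b ++ b') j m = digit d b j m.
Proof. by move=> mj; rewrite /digit nth_cat mj. Qed.

Lemma node_digit_cat K d b b' j m : (j < d)%N -> (m * d <= size b)%N ->
  node K (digit d (b ++ b') j) m = node K (digit d b j) m.
Proof. by move=> jd mb; apply: eq_node => l lm; apply: digit_cat; nia. Qed.

Definition coord_center (K d : nat) (b : seq bool) (j m : nat) : int :=
  icenter K (digit d b j) m (m * d + j < size b)%N.

(** The last coin of [b] is that of the current request; its index [(size b).-1] determines the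
    phase. *)
Definition request (R : realType) (d K : nat) (b : seq bool) : cube R d :=
  let m := ((size b).-1 %/ d)%N in
  (\row_(j < d) (coord_center K d b j m)%:~R, (2 * scale K m.+1 - 1)%:~R).

Lemma hits_requestP (R : realType) (d K : nat) (b : seq bool) (p : zpoint d) :
  let m := ((size b).-1 %/ d)%N in
  reflect (forall j : 'I_d,
    `|p ord0 j - coord_center K d b j m| <= 2 * scale K m.+1 - 1)
    (hits p (request R d K b)).
Proof.
apply: (iffP forallP) => H j; have := H j.
  by rewrite mxE -rmorphB -intr_norm ler_int.
by rewrite mxE -rmorphB -intr_norm ler_int.
Qed.

Lemma phase_lt (d K : nat) (b : seq bool) : (0 < size b <= K * d)%N ->
  ((size b).-1 %/ d < K)%N.
Proof. by move=> sb; rewrite ltn_divLR; nia. Qed.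

(** The instance of [U]: each coin confines the useful points to an open half-space. *)
Definition region (d K : nat) (b : seq bool) (p : zpoint d) : bool :=
  `[< forall (j : 'I_d) (m : nat), (m * d + j < size b)%N ->
      0 < sgb (digit d b j m) * (p ord0 j - node K (digit d b j) m) >].

Lemma region_rcons d K b e (p : zpoint d) :
  region K (rcons b e) p -> region K b p.
Proof.
move=> /asboolP H; apply/asboolP => j m mj; have := H j m.
rewrite size_rcons ltnW// -cats1 digit_cat// node_digit_cat//; first exact.
by lia.
Qed.

Lemma region_disjoint d K b (p : zpoint d) : (0 < d)%N ->
  region K (rcons b false) p -> ~~ region K (rcons b true) p.
Proof.
move=> d0 /asboolP H0; apply/negP => /asboolP H1.
(* The coin of index [size b], where the two outcomes differ, moves coordinate [j] in phase [m]. *)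
pose j := Ordinal (ltn_pmod (size b) d0); pose m := (size b %/ d)%N.
have mj : (m * d + j = size b)%N by rewrite [RHS](divn_eq _ d).
move: (H0 j m) (H1 j m); rewrite !size_rcons mj ltnSn => /(_ isT) + /(_ isT).
rewrite -!cats1 !node_digit_cat// ?leq_trunc_div// /digit !mj !nth_cat ltnn subnn.
by rewrite /sgb/=; lia.
Qed.

Lemma hits_request_region (R : realType) d K b (p : zpoint d) :
  (size b <= K * d)%N -> hits p (request R d K b) -> region K b p.
Proof.
move=> sb /hits_requestP H; apply/asboolP => j m mj.
have b0 : (0 < size b <= K * d)%N by rewrite sb andbT; lia.
have mle : (m <= (size b).-1 %/ d)%N by rewrite leq_divRL; lia.
apply: icenter_side (H j); first exact: phase_lt.
move: mle; rewrite leq_eqVlt => /predU1P[<-|ltm]; first by rewrite mj addn1.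
by rewrite ltn_addr.
Qed.

(** Coins beyond the end of [b] read as [false]; every continuation stays within the cubes already
    requested. *)
Definition target (d K : nat) (b : seq bool) : zpoint d :=
  \row_(j < d) node K (digit d b j) K.

Lemma hits_target (R : realType) d K b b' : (0 < size b <= K * d)%N ->
  hits (target d K (b ++ b')) (request R d K b).
Proof.
move=> sb; apply/hits_requestP => j; set m := (_ %/ d)%N; rewrite mxE.
have mb : (m * d <= size b)%N.
  by apply: leq_trans (leq_trunc_div _ _) _; exact: leq_pred.
suff -> : coord_center K d b j m =
    icenter K (digit d (b ++ b') j) m (m * d + j < size b)%N.
  by apply: node_near_icenter; exact: phase_lt.
rewrite /coord_center /icenter node_digit_cat//.
by case: ltnP => // mj; rewrite digit_cat.
Qed.

Lemma request_allowed (R : realType) d K b (M : R) : (0 < size b <= K * d)%N ->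
  4 ^+ K <= M -> allowed M (request R d K b).
Proof.
move=> sb KM; set m := ((size b).-1 %/ d)%N; have mK : (m < K)%N := phase_lt sb.
rewrite /allowed /request /= -/m.
apply/andP; split; first by rewrite (ler_int _ 1); have := scale_gt0 K m.+1; lia.
apply: le_trans KM; have -> : 4 ^+ K = (scale K 0)%:~R :> R.
  by rewrite /scale subn0 -pmulrn natrX.
rewrite ler_int; have := scale_anti K (leq0n m).
by rewrite (scaleS mK); have := scale_gt0 K m.+1; lia.
Qed.

Definition requests (R : realType) (d K : nat) (b : seq bool) : seq (cube R d) :=
  [seq request R d K (take k.+1 b) | k <- iota 0 (size b)].

Lemma requests_rcons (R : realType) d K b e :
  requests R d K (rcons b e) =
  rcons (requests R d K b) (request R d K (rcons b e)).
Proof.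
rewrite /requests size_rcons -addn1 iotaD map_cat add0n /= cats1.
rewrite take_oversize ?size_rcons//; congr rcons.
apply/eq_in_map => k; rewrite mem_iota add0n /= => kb.
by rewrite -cats1 takel_cat.
Qed.

Lemma requestsP (R : realType) d K b Q : (size b <= K * d)%N ->
  Q \in requests R d K b ->
  exists b1 b2, [/\ b = b1 ++ b2, (0 < size b1 <= K * d)%N & Q = request R d K b1].
Proof.
move=> sb /mapP[k]; rewrite mem_iota add0n /= => kb ->.
exists (take k.+1 b), (drop k.+1 b); split; rewrite ?cat_take_drop//.
by rewrite size_takel//; lia.
Qed.

Lemma requests_allowed (R : realType) d K b (M : R) : (size b <= K * d)%N ->
  4 ^+ K <= M -> all (allowed M) (requests R d K b).
Proof.
move=> sb KM; apply/allP => Q /(requestsP sb)[b1 [b2 [_ sb1 ->]]].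
exact: request_allowed.
Qed.

Lemma requests_opt (R : realType) d K b : (0 < size b <= K * d)%N ->
  is_opt (requests R d K b) 1.
Proof.
move=> /andP[b0 sb]; split=> [|H hitH].
  exists [fset target d K b]; rewrite cardfs1; split=> // Q.
  move=> /(requestsP sb)[b1 [b2 [-> sb1 ->]]].
  by exists (target d K (b1 ++ b2)); [rewrite inE | exact: hits_target].
have [p pH _] : exists2 p, p \in H & hits p (request R d K (take 1 b)).
  by apply: hitH; apply/mapP; exists 0%N; rewrite // mem_iota.
by rewrite cardfs_gt0; apply/fset0Pn; exists p.
Qed.

(** * The bound on the competitive ratio *)

Lemma comp_ratio_ge (R : realType) (d K : nat) (M : R) (d0 : measure_display)
    (Omega : measurableType d0) (P : probability Omega R)
    (A : Omega -> seq (cube R d) -> {fset zpoint d}) :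
  (0 < d)%N -> (0 < K)%N -> 4 ^+ K <= M ->
  (forall w, online_alg M (A w)) ->
  (forall s, measurable_fun setT (fun w => ((#|` A w s|)%:R : R))) ->
  (((K * d)%:R / 2)%:E <= comp_ratio M P A)%E.
Proof.
move=> d_gt0 K_gt0 KM onA mA; pose T := (K * d)%N.
pose f w b := #|` A w (requests R d K b)|.
have fT w : 2 ^+ T * (T%:R / 2) <= (leaf_sum (f w) T [::])%:R :> R.
  have [Ahit Amono] := onA w.
  suff : (2 ^ T * T <= 2 * leaf_sum (f w) T [::])%N.
    rewrite -(ler_nat R) !natrM natrX; lra.
  apply: (leaf_sum_card_ge (U := region K)) => [b e bT|b e p|b p|b e bT].
  - by rewrite requests_rcons; apply: Amono; rewrite -requests_rcons;
      apply: requests_allowed; rewrite ?size_rcons.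
  - exact: region_rcons.
  - exact: region_disjoint.
  - have beT : (size (rcons b e) <= K * d)%N by rewrite size_rcons.
    have [|p pA] := Ahit _ (requests_allowed beT KM) (request R d K (rcons b e)).
      by rewrite requests_rcons mem_rcons inE eqxx.
    by move=> /(hits_request_region beT); exists p.
have mf b : measurable_fun setT (fun w => (f w b)%:R : R) by exact: mA.
have [|t tT ft] := @exists_leaf_integral_ge _ _ _ P f (T%:R / 2) T [::] mf.
  rewrite -[leLHS]mule1 -(probability_setT P) -integral_cst//.
  apply: ge0_le_integral => //.
  - by move=> w _; rewrite lee_fin mulr_ge0.
  - by apply/measurable_EFinP; exact: measurable_leaf_sum.
  - by move=> w _; rewrite lee_fin.
apply: le_trans ft _; apply: ereal_sup_ubound.
have tb : (0 < size t <= K * d)%N by rewrite tT muln_gt0 K_gt0 d_gt0 /=.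
exists (requests R d K t), 1%N; split.
- by apply/eqP; rewrite -size_eq0 size_map size_iota; lia.
- by apply: requests_allowed => //; rewrite tT.
- exact: requests_opt.
- by rewrite invr1 mule1.
Qed.

Theorem theorem1 (R : realType) :
  exists c : R, 0 < c /\ exists M0 : R, 1 < M0 /\
  forall (d : nat) (M : R), (1 <= d)%N -> M0 <= M ->
  forall (d0 : measure_display) (Omega : measurableType d0)
         (P : probability Omega R)
         (A : Omega -> seq (cube R d) -> {fset zpoint d}),
    (forall w, online_alg M (A w)) ->
    (forall s, measurable_fun setT (fun w => ((#|` A w s|)%:R : R))) ->
    ((c * d%:R * ln M)%:E <= comp_ratio M P A)%E.
Proof.
have ln4 : 0 < ln (4 : R) by apply: ln_gt0; lra.
(* With [K] the integer part of [ln M / ln 4], the threshold 4 for [M] gives [1 <= K], so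
   [2 * K >= K + 1 > ln M / ln 4], and [K * d / 2] exceeds a quarter of [d * ln M / ln 4]. *)
exists (4 * ln 4)^-1; split; first by rewrite invr_gt0 mulr_gt0.
exists 4; split; first by lra.
move=> d M d_gt0 M4 d0 Omega P A onA mA.
have M0 : 0 < M by lra.
have lnM : ln 4 <= ln M by rewrite ler_ln ?posrE.
pose K := Num.truncn (ln M / ln 4).
have /andP[K_le K_gt] : K%:R <= ln M / ln 4 < K.+1%:R.
  by apply: truncn_itv; rewrite divr_ge0//; lra.
have K_gt0 : (0 < K)%N by rewrite truncn_gt0 ler_pdivlMr ?mul1r.
clearbody K.
have KM : 4 ^+ K <= M.
  have p4 : 0 < 4 ^+ K :> R by rewrite exprn_gt0.
  by rewrite -ler_ln ?posrE// lnXn// -[leLHS]mulr_natl -ler_pdivlMr//.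
apply: le_trans (comp_ratio_ge P d_gt0 K_gt0 KM onA mA); rewrite lee_fin.
have -> : (4 * ln 4)^-1 * d%:R * ln M = (ln M / ln 4) * (d%:R / 4).
  by field; rewrite gt_eqF.
have K1 : 1 <= K%:R :> R by rewrite ler1n.
have -> : (K * d)%:R / 2 = (2 * K%:R) * (d%:R / 4) :> R by rewrite natrM; field.
rewrite ler_wpM2r ?divr_ge0//; apply/ltW/(lt_le_trans K_gt).
by rewrite -natr1; lra.
Qed.
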